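(* Let $d\ge1$, let $r\in[2,\infty)$, let $m$ be any real number, and let $\mathbf c$ be any nonzero vector in $\mathbb R^d$. Let $(\mathbf X_t)_{t\ge0}$ be a stationary random walk Metropolis--Hastings (RWMH) chain on $\mathbb R^d$ with target density $\pi$ and proposal step-density $\phi$ (both with respect to Lebesgue measure). If $\mathbf X_0\in L^r$, then $$\mathbb E|\langle\mathbf c,\mathbf X_1-\mathbf X_0\rangle|^r<2^{r-1}\,\mathbb E|\langle\mathbf c,\mathbf X_0\rangle-m|^r.$$
   Context: RWMH chain: $\pi$ and $\phi$ are probability densities on $\mathbb R^d$ with respect to Lebesgue measure, with no further conditions. Set $q(\mathbf x,\mathbf y)=\phi(\mathbf y-\mathbf x)$ and $$\alpha(\mathbf x,\mathbf y)=\begin{cases}\min\{1,\ \pi(\mathbf y)q(\mathbf y,\mathbf x)/(\pi(\mathbf x)q(\mathbf x,\mathbf y))\},&\pi(\mathbf x)q(\mathbf x,\mathbf y)>0,\\ 1,&\pi(\mathbf x)q(\mathbf x,\mathbf y)=0.\end{cases}$$ From state $\mathbf x$, the Markov chain proposes $\mathbf y$ drawn from the density $q(\mathbf x,\cdot)$, moves to $\mathbf y$ with probability $\alpha(\mathbf x,\mathbf y)$, and otherwise stays at $\mathbf x$. The chain is stationary: $\mathbf X_0$ (hence every $\mathbf X_t$) has density $\pi$. No irreducibility is assumed. $\langle\cdot,\cdot\rangle$ and $\|\cdot\|$ are the Euclidean inner product and norm, and $\mathbf X_0\in L^r$ means $\mathbb E\|\mathbf X_0\|^r<\infty$. *)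

(* Defs.v *)
From HB Require Import structures.
From mathcomp Require Import all_boot all_order all_algebra.
From mathcomp Require Import all_classical all_reals all_analysis.
Import Order.TTheory GRing.Theory Num.Theory.
Import numFieldNormedType.Exports.

Set Implicit Arguments.
Unset Strict Implicit.
Unset Printing Implicit Defensive.

Local Open Scope classical_set_scope.
Local Open Scope ring_scope.

Definition rV_display : measure_display -> measure_display.
Proof. exact. Qed.

(* The product sigma-algebra, generated by the coordinates, as the library does
   for n.-tuple T; over the reals it is the Borel sigma-algebra. *)
Section measurable_rV.
Context {d} {T : measurableType d} (n : nat).

Definition rV_coor (i : 'I_n) (x : 'rV[T]_n) : T := x ord0 i.

Let rV_set0 : g_sigma_preimage rV_coor set0.
Proof. exact: sigma_algebra0. Qed.

Let rV_setC A : g_sigma_preimage rV_coor A -> g_sigma_preimage rV_coor (~` A).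
Proof. exact: sigma_algebraC. Qed.

Let rV_bigcup (F : (set 'rV[T]_n)^nat) :
  (forall i, g_sigma_preimage rV_coor (F i)) ->
  g_sigma_preimage rV_coor (\bigcup_i (F i)).
Proof. exact: sigma_algebra_bigcup. Qed.

HB.instance Definition _ := @isMeasurable.Build (rV_display d)
  'rV[T]_n (g_sigma_preimage rV_coor) rV_set0 rV_setC rV_bigcup.

End measurable_rV.

Lemma measurable_coor d (T : measurableType d) n (i : 'I_n) :
  measurable_fun [set: 'rV[T]_n] (fun x => x ord0 i).
Proof.
move=> _ Y mY; rewrite setTI; apply: sub_sigma_algebra => /=.
rewrite -bigcup_seq/=; exists i => /=; first by rewrite mem_index_enum.
by exists Y => //; rewrite setTI.
Qed.

Lemma measurable_fun_rVP d1 d2 (T1 : measurableType d1)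
    (T2 : measurableType d2) n (f : T1 -> 'rV[T2]_n) :
  measurable_fun [set: T1] f <->
  forall i, measurable_fun [set: T1] (fun t => f t ord0 i).
Proof.
split=> [mf i|mf].
  exact: (measurableT_comp (measurable_coor i) mf).
apply: (@measurability _ _ _ _ setT f
   (\big[setU/set0]_(i < n) preimage_set_system setT (@rV_coor _ T2 n i) measurable)) => //.
move=> _ [B + <-]; rewrite -bigcup_seq => -[i /= _ [C mC <-]].
by rewrite !setTI; have := mf i measurableT C mC; rewrite setTI.
Qed.

Section lebesgue_rV.
Context {R : realType}.
Local Open Scope ereal_scope.

Definition cons_rV n (p : measurableTypeR R * 'rV[R]_n) : 'rV[R]_n.+1 :=
  row_mx (p.1 : R)%:M p.2.

Let uncons_rV n (x : 'rV[R]_n.+1) :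
    measurableTypeR R * 'rV[R]_n :=
  (x ord0 ord0, \row_i x ord0 (lift ord0 i)).

Lemma cons_rV0 n (p : measurableTypeR R * 'rV[R]_n) : cons_rV p ord0 ord0 = p.1.
Proof.
rewrite (_ : @ord0 n = @lshift 1 n ord0); last exact/val_inj.
by rewrite [LHS]row_mxEl mxE eqxx mulr1n.
Qed.

Lemma cons_rVS n (p : measurableTypeR R * 'rV[R]_n) i :
  cons_rV p ord0 (lift ord0 i) = p.2 ord0 i.
Proof.
rewrite (_ : lift ord0 i = @rshift 1 n i); last exact/val_inj.
exact: row_mxEr.
Qed.

Let cons_rVK n : cancel (@cons_rV n) (@uncons_rV n).
Proof.
move=> [x v]; rewrite /uncons_rV cons_rV0; congr pair.
by apply/rowP => i; rewrite mxE cons_rVS.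
Qed.

Lemma measurable_cons_rV n :
  measurable_fun [set: measurableTypeR R * 'rV[R]_n] (@cons_rV n).
Proof.
apply/measurable_fun_rVP => i; case: (unliftP ord0 i) => [j ->|->].
  under eq_fun do rewrite cons_rVS.
  exact: (measurableT_comp (measurable_coor j) measurable_snd).
by under eq_fun do rewrite cons_rV0; exact: measurable_fst.
Qed.

Let measurable_uncons_rV n : measurable_fun setT (@uncons_rV n).
Proof.
apply/measurable_fun_pair => /=; first exact: measurable_coor.
apply/measurable_fun_rVP => i.
by under eq_fun do rewrite mxE; exact: measurable_coor.
Qed.

Section step.
Variables (n : nat) (mu : {sigma_finite_measure set 'rV[R]_n -> \bar R}).

Definition lebesgue_cons : set 'rV[R]_n.+1 -> \bar R :=
  pushforward (lebesgue_measure \x mu) (@cons_rV n).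

Let lebesgue_cons0 : lebesgue_cons set0 = 0.
Proof. by rewrite /lebesgue_cons /pushforward preimage_set0 measure0. Qed.

Let lebesgue_cons_ge0 A : 0 <= lebesgue_cons A.
Proof. exact: (measure_ge0 (lebesgue_measure \x mu)). Qed.

Let lebesgue_cons_sigma_additive : semi_sigma_additive lebesgue_cons.
Proof.
move=> F mF tF mUF; rewrite /lebesgue_cons /pushforward preimage_bigcup.
have mpre B : measurable B -> measurable (@cons_rV n @^-1` B).
  by move=> mB; rewrite -[X in measurable X]setTI; exact: measurable_cons_rV.
apply: measure_semi_sigma_additive; first by move=> k; exact: mpre.
- apply/trivIsetP => /= i j _ _ ij; rewrite -preimage_setI.
  by move/trivIsetP : tF => /(_ _ _ _ _ ij) ->//; rewrite preimage_set0.
- by rewrite -preimage_bigcup; exact: mpre.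
Qed.

HB.instance Definition _ := isMeasure.Build _ _ _ lebesgue_cons
  lebesgue_cons0 lebesgue_cons_ge0 lebesgue_cons_sigma_additive.

Let lebesgue_cons_sigma_finite : sigma_finite setT lebesgue_cons.
Proof.
have /sigma_finiteP[F [TF ndF Foo]] := sigma_finiteT (@lebesgue_measure R).
have /sigma_finiteP[G [TG ndG Goo]] := sigma_finiteT mu.
exists (fun k => @uncons_rV n @^-1` (F k `*` G k)).
  rewrite -preimage_bigcup -[LHS](preimage_setT (@uncons_rV n)).
  congr (_ @^-1` _); apply/seteqP; split => // -[x v] _.
  have [i _ Fix] : (\bigcup_i F i) x by rewrite -TF.
  have [j _ Gjv] : (\bigcup_i G i) v by rewrite -TG.
  exists (maxn i j) => //; split => /=.
  - by move: x Fix; exact/subsetPset/ndF/leq_maxl.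
  - by move: v Gjv; exact/subsetPset/ndG/leq_maxr.
move=> k; have [mFk Fkoo] := Foo k; have [mGk Gkoo] := Goo k; split.
  rewrite -[X in measurable X]setTI; apply: measurable_uncons_rV => //.
  exact: measurableX.
rewrite /lebesgue_cons /pushforward -comp_preimage.
rewrite (_ : _ \o _ = id); last by apply/funext => p /=; rewrite cons_rVK.
by rewrite product_measure1E// lte_mul_pinfty// ge0_fin_numE.
Qed.

HB.instance Definition _ := Measure_isSigmaFinite.Build _ _ _ lebesgue_cons
  lebesgue_cons_sigma_finite.

End step.

Fixpoint lebesgue_rV n : {sigma_finite_measure set 'rV[R]_n -> \bar R} :=
  match n with
  | 0 => \d_ (0%R : 'rV[R]_0)
  | n'.+1 => lebesgue_cons (lebesgue_rV n')
  end.

Lemma lebesgue_rV_box n (A : 'I_n -> set R) :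
  (forall i, measurable (A i)) ->
  lebesgue_rV n [set x | forall i, A i (x ord0 i)] =
  \prod_(i < n) lebesgue_measure (A i).
Proof.
elim: n A => [|n IH] A mA.
  by rewrite big_ord0 /= diracE mem_set//= => -[].
rewrite big_ord_recl /= /lebesgue_cons /pushforward -IH//.
have mB : measurable [set x : 'rV[R]_n | forall i, A (lift ord0 i) (x ord0 i)].
  rewrite [X in measurable X](_ : _ = \bigcap_(i in [set: 'I_n])
      ((fun x : 'rV[R]_n => x ord0 i) @^-1` A (lift ord0 i))).
    apply: fin_bigcap_measurable => // i _.
    by rewrite -[X in measurable X]setTI; exact: measurable_coor.
  by apply/seteqP; split => [x /= + i _|x /= + i]; apply.
rewrite -product_measure1E; [|exact: mA|exact: mB].
congr ((_ \x _)%E _); apply/seteqP; split => [[x v]/= H|[x v]/= [H1 H2] i].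
  split; first by have := H ord0; rewrite cons_rV0.
  by move=> i; have := H (lift ord0 i); rewrite cons_rVS.
case: (unliftP ord0 i) => [j ->|->]; first by rewrite cons_rVS.
by rewrite cons_rV0.
Qed.

End lebesgue_rV.

Section euclidean.
Context {R : realType} (d : nat).
Implicit Types x y : 'rV[R]_d.

Definition dotp x y : R := \sum_(i < d) x ord0 i * y ord0 i.

(* The library's norm `|x| on 'rV[R]_d is the sup norm. *)
Definition enorm x : R := Num.sqrt (dotp x x).

End euclidean.

Section rwmh.
Context {R : realType} (d : nat).
Local Open Scope ereal_scope.

Definition is_density (f : 'rV[R]_d -> R) : Prop :=
  [/\ measurable_fun setT f, (forall x, 0 <= f x)%R &
      \int[lebesgue_rV d]_x (f x)%:E = 1].

Definition has_density (mu : set 'rV[R]_d -> \bar R) (f : 'rV[R]_d -> R) : Prop :=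
  forall A, measurable A -> mu A = \int[lebesgue_rV d]_(x in A) (f x)%:E.

Variables pi phi : 'rV[R]_d -> R.

Definition rw_proposal (x y : 'rV[R]_d) : R := phi (y - x)%R.

Local Notation q := rw_proposal.

Definition acceptance (x y : 'rV[R]_d) : R :=
  (if 0 < pi x * q x y then Num.min 1 (pi y * q y x / (pi x * q x y)) else 1)%R.

(* Law of the next state from x: the accepted proposals have sub-density
   acceptance x * q x, and the rejected mass stays at x. *)
Definition rwmh_kernel (x : 'rV[R]_d) (A : set 'rV[R]_d) : \bar R :=
  \int[lebesgue_rV d]_(y in A) (acceptance x y * q x y)%:E +
  (\int[lebesgue_rV d]_y ((1 - acceptance x y) * q x y)%:E) * \d_x A.

End rwmh.

(* P(X_{n+1} \in A | X_0, ..., X_n) = K(X_n, A) almost surely, with conditional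
   probability written out as integrals over the events of the natural
   filtration. *)
Definition markov_chain {d d'} {Omega : measurableType d}
    {S : measurableType d'} {R : realType} (P : probability Omega R)
    (K : S -> set S -> \bar R) (X : nat -> {RV P >-> S}) : Prop :=
  forall (n : nat) (E : set Omega) (A : set S),
    g_sigma_preimage (fun i : 'I_n.+1 => (X i : Omega -> S)) E ->
    measurable A ->
    P (E `&` X n.+1 @^-1` A) = (\int[P]_(w in E) K (X n w) A)%E.

Definition stationary_rwmh {dO} {Omega : measurableType dO} {R : realType}
    (P : probability Omega R) (d : nat) (pi phi : 'rV[R]_d -> R)
    (X : nat -> {RV P >-> 'rV[R]_d}) : Prop :=
  has_density (distribution P (X 0%N)) pi /\
  markov_chain (rwmh_kernel pi phi) X.

(* Main.v *)
From HB Require Import structures.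
Require Import Defs.
From mathcomp Require Import all_boot all_order all_algebra.
From mathcomp Require Import all_classical all_reals all_analysis.
From mathcomp Require Import measurable_realfun ring lra.
Import Order.TTheory GRing.Theory Num.Theory.
Import numFieldNormedType.Exports.

Set Implicit Arguments.
Unset Strict Implicit.
Unset Printing Implicit Defensive.

(** Put [a = <c, x> - m], [t = <c, s>] for a state [x] and a step [s]. By detailed
    balance ([accepted_flow]) and translation invariance, the left-hand side is
    the integral over [(x, s)] of
      [|t|^r * min (phi s * pi x, phi (- s) * pi (x + s))]
    ([rwmh_increment_expectation]). Convexity alone bounds [|t|^r] by
    [2^(r-1) (|a|^r + |a + t|^r)], which loses a factor 2 since each state is
    then charged both for the steps [s] and [- s]. The remedy is to charge a
    state only for steps towards the level [<c, x> = m] ([crossing_bound]): a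
    step that does not cross the level is paid for by its farther endpoint
    alone, which lies at distance at least [|t|]; a step that crosses it is paid
    for by both endpoints, and then Cauchy-Schwarz absorbs the asymmetry of
    [phi] and convexity of the power [r / 2] gives the constant [2^(r-2)]
    ([crossing_le]). On a line of states [x + k s] every state is charged for at
    most one neighbour, so integrating yields exactly
    [2^(r-1) E |<c, X_0> - m|^r] ([integral_flow_bound]).

    Strictness: where the charge is positive, equality in the pointwise bound
    forces, for a given step, one of three values of [<c, x>] ([crossing_lt]),
    hence happens on a null set ([flow_tight_null]). As the right-hand side is
    positive and finite ([centered_moment_gt0], [linear_moment_fin]), this makes
    the integrated inequality strict ([integral_lt_bound]). *)

Local Open Scope classical_set_scope.
Local Open Scope ring_scope.

Import HBNNSimple.

(** * Measures with a density and measures on a product *)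

(** The integral formula holds for simple functions by the values on sets, and
    passes to the limit by monotone convergence. *)
Lemma density_measure (d : measure_display) (T : measurableType d)
    (R : realType) (mu : {measure set T -> \bar R}) (f : T -> R) :
  measurable_fun setT f -> (forall x, 0 <= f x) ->
  exists nu : {measure set T -> \bar R},
    (forall A, nu A = \int[mu]_(x in A) (f x)%:E)%E /\
    (forall g : T -> \bar R, measurable_fun setT g -> (forall x, 0 <= g x) ->
       \int[nu]_x g x = \int[mu]_x (g x * (f x)%:E))%E.
Proof.
move=> mf f0.
have mfE : measurable_fun setT (EFin \o f) by exact/measurable_EFinP.
pose nu A := (\int[mu]_(x in A) (f x)%:E)%E.
have nu0 : nu set0 = 0%E by exact: integral_set0.
have nu_ge0 A : (0 <= nu A)%E by apply: integral_ge0 => x _; rewrite lee_fin.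
have nu_add : semi_sigma_additive nu.
  by apply: semi_sigma_additive_nng_induced => // x; rewrite lee_fin.
pose nuB := isMeasure.Build _ _ _ nu nu0 nu_ge0 nu_add.
pose nuM : {measure set T -> \bar R} := HB.pack nu nuB.
exists nuM; split => // g mg g0.
pose h := nnsfun_approx measurableT mg.
have cvg_h x : (EFin \o h ^~ x) @ \oo --> g x.
  by apply: (cvg_nnsfun_approx measurableT mg) => // y _; rewrite lee_fin.
have nd_h x m n : (m <= n)%N -> h m x <= h n x.
  by move=> mn; exact/lefP/nd_nnsfun_approx.
transitivity (limn (fun n => \int[nuM]_x (h n x)%:E))%E.
  rewrite -monotone_convergence//.
  - by apply: eq_integral => x _; apply/esym/cvg_lim => //; exact: cvg_h.
  - by move=> n; exact/measurable_EFinP.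
  - by move=> n x _; rewrite lee_fin.
  - by move=> x _ m n mn; rewrite lee_fin nd_h.
transitivity (limn (fun n => \int[mu]_x ((h n x)%:E * (f x)%:E)))%E; last first.
  rewrite -monotone_convergence//.
  - apply: eq_integral => x _; apply/cvg_lim => //.
    by apply: cvgeZr => //; exact: cvg_h.
  - by move=> n; apply: emeasurable_funM => //; exact/measurable_EFinP.
  - by move=> n x _; rewrite mule_ge0// lee_fin.
  - by move=> x _ m n mn; rewrite lee_wpmul2r// lee_fin// nd_h.
congr (limn _); apply/funext => n.
rewrite integralT_nnsfun sintegralE.
transitivity (\int[mu]_x
    (\sum_(r \in range (h n)) (r * \1_(h n @^-1` [set r]) x * f x)%R%:E))%E; last first.
  apply: eq_integral => x _; rewrite -EFinM fimfunE fsumEFin//; congr (_%:E).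
  by rewrite !fsbig_finite//= mulr_suml.
rewrite ge0_integral_fsum//; last 2 first.
  - move=> r; apply/measurable_EFinP; apply: measurable_funM => //.
    exact: measurable_funM.
  - move=> r x _; rewrite lee_fin mulr_ge0//.
    by have := nnfun_muleindic_ge0 (h n) r x; rewrite -EFinM lee_fin.
apply: eq_fsbigr => r rh.
have r0 : 0 <= r by move: rh; rewrite inE => -[x _ <-].
under eq_integral do rewrite -mulrA EFinM.
rewrite ge0_integralZl//; last 2 first.
  - by apply/measurable_EFinP; exact: measurable_funM.
  - by move=> x _; rewrite lee_fin mulr_ge0.
congr (_ * _)%E.
rewrite -[LHS]/(nu (h n @^-1` [set r])) /nu integral_mkcond; apply: eq_integral => x _.
by rewrite epatch_indic muleC EFinM.
Qed.

(** Measurable rectangles are stable under intersection and generate the product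
    sigma-algebra, so the uniqueness theorem for measures applies. *)
Lemma finite_measure_eq_rect (d1 d2 : measure_display) (T1 : measurableType d1)
    (T2 : measurableType d2) (R : realType)
    (m1 m2 : {measure set (T1 * T2) -> \bar R}) :
  (m1 setT < +oo)%E ->
  (forall A B, measurable A -> measurable B -> m1 (A `*` B) = m2 (A `*` B)) ->
  forall C, measurable C -> m1 C = m2 C.
Proof.
move=> m1oo m12 C mC.
pose G : set (set (T1 * T2)) := [set A `*` B | A in measurable & B in measurable].
apply: (measure_unique G (fun=> setT)) => //.
- exact: measurable_prod_measurableType.
- move=> _ _ [A1 mA1 [B1 mB1 <-]] [A2 mA2 [B2 mB2 <-]].
  exists (A1 `&` A2); first exact: measurableI.
  by exists (B1 `&` B2); [exact: measurableI|rewrite setXI].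
- by move=> _; exists setT => //; exists setT => //; rewrite setXTT.
- by apply/seteqP; split => // x _; exists 0%N.
- by move=> _ [A mA [B mB <-]]; exact: m12.
Qed.

(** * Lebesgue measure: translations, reflection, hyperplanes *)

Lemma lebesgue_measure_shift (R : realType) (a : R) (A : set (measurableTypeR R)) :
  measurable A -> lebesgue_measure ((fun x => x + a) @^-1` A) = lebesgue_measure A.
Proof.
move=> mA.
have mf : measurable_fun setT (fun x : measurableTypeR R => (x + a) : measurableTypeR R).
  exact: measurable_funD.
pose fB := isMeasurableFun.Build _ _ _ _ _ mf.
pose f : {mfun measurableTypeR R >-> measurableTypeR R} :=
  HB.pack (fun x : measurableTypeR R => (x + a) : measurableTypeR R) fB.
rewrite -[LHS]/(pushforward lebesgue_measure f A).
apply/esym/lebesgue_measure_unique => //= _ [[u v]] _ <-.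
rewrite /pushforward.
have -> : f @^-1` [set` `]u, v]] = [set` `]u - a, v - a]].
  by apply/seteqP; split => x /=; rewrite !in_itv/= => /andP[ux xv]; apply/andP; split; lra.
by rewrite /= !lebesgue_measure_itv/= !lte_fin ltrD2r -!EFinB opprB addrA addrNK.
Qed.

Lemma integral_lebesgue_rVS (R : realType) (n : nat) (f : 'rV[R]_n.+1 -> \bar R) :
  measurable_fun setT f -> (forall x, 0 <= f x)%E ->
  (\int[lebesgue_rV n.+1]_x f x =
   \int[lebesgue_measure]_x \int[lebesgue_rV n]_v f (cons_rV (x, v)))%E.
Proof.
move=> mf f0.
rewrite -[LHS]/(\int[pushforward (lebesgue_measure \x lebesgue_rV n) (@cons_rV R n)]_x f x)%E.
rewrite ge0_integral_pushforward//; last exact: measurable_cons_rV.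
rewrite preimage_setT fubini_tonelli1//.
- by apply: measurableT_comp => //; exact: measurable_cons_rV.
- by move=> x /=.
Qed.

(** Lebesgue measure is a product, so any map that acts on each coordinate by a
    measure-preserving map of the line preserves it; translations and the
    reflection through the origin are the two instances used. *)
Lemma integral_lebesgue_rV_coord (R : realType) (n : nat)
    (s : 'I_n -> measurableTypeR R -> measurableTypeR R)
    (f : 'rV[R]_n -> \bar R) :
  (forall i, measurable_fun setT (s i)) ->
  (forall i A, measurable A -> lebesgue_measure (s i @^-1` A) = lebesgue_measure A) ->
  measurable_fun setT f -> (forall x, 0 <= f x)%E ->
  (\int[lebesgue_rV n]_x f (\row_i s i (x ord0 i)) = \int[lebesgue_rV n]_x f x)%E.
Proof.
elim: n s f => [|n IH] s f ms ls mf f0.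
  by apply: eq_integral => x _; congr f; apply/rowP => -[].
have mrow m (t : 'I_m -> measurableTypeR R -> measurableTypeR R) :
    (forall i, measurable_fun setT (t i)) ->
    measurable_fun [set: 'rV[R]_m]
      (fun x : 'rV[R]_m => \row_i (t i (x ord0 i) : R) : 'rV[R]_m).
  move=> mt; apply/measurable_fun_rVP => i.
  by under eq_fun do rewrite mxE; exact: (measurableT_comp (mt i) (measurable_coor i)).
rewrite !integral_lebesgue_rVS//; last by apply: measurableT_comp => //; exact: mrow.
pose s' i := s (lift ord0 i).
have E (x : measurableTypeR R) v : \row_i s i (cons_rV (x, v) ord0 i) =
    cons_rV (s ord0 x, \row_i (s' i (v ord0 i) : R)).
  apply/rowP => i; rewrite mxE; case: (unliftP ord0 i) => [j ->|->].
    by rewrite !cons_rVS/= mxE.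
  by rewrite !cons_rV0.
under eq_integral => x _ do under eq_integral => v _ do rewrite E.
have mfc x : measurable_fun setT (fun v => f (cons_rV (x, v))).
  apply: measurableT_comp => //.
  exact: (measurableT_comp (@measurable_cons_rV R n) (measurable_pair1 x)).
have IHx x : (\int[lebesgue_rV n]_v f (cons_rV (s ord0 x, \row_i (s' i (v ord0 i) : R))) =
    \int[lebesgue_rV n]_v f (cons_rV (s ord0 x, v)))%E.
  by apply: (IH s' (fun v => f (cons_rV (s ord0 x, v)))) => // i *; [exact: ms|exact: ls].
under eq_integral => x _ do rewrite IHx.
pose g (x : measurableTypeR R) := (\int[lebesgue_rV n]_v f (cons_rV (x, v)))%E.
rewrite -[LHS]/(\int[lebesgue_measure]_x (g \o s ord0) x)%E.
rewrite -[RHS]/(\int[lebesgue_measure]_x g x)%E.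
rewrite -[in LHS](preimage_setT (s ord0)) -ge0_integral_pushforward//.
- by apply: eq_measure_integral => A mA _; exact: ls.
- have mfc' : measurable_fun setT (f \o @cons_rV R n).
    by apply: measurableT_comp => //; exact: measurable_cons_rV.
  by apply: (measurable_fun_fubini_tonelli_F _ mfc') => x; exact: f0.
- by move=> x _; apply: integral_ge0.
Qed.

Lemma integral_lebesgue_rV_shift (R : realType) (n : nat) (a : 'rV[R]_n)
    (f : 'rV[R]_n -> \bar R) :
  measurable_fun setT f -> (forall x, 0 <= f x)%E ->
  (\int[lebesgue_rV n]_x f (x + a)%R = \int[lebesgue_rV n]_x f x)%E.
Proof.
move=> mf f0.
rewrite -(@integral_lebesgue_rV_coord _ _ (fun i x => x + a ord0 i) f)//.
- by apply: eq_integral => x _; congr f; apply/rowP => i; rewrite !mxE.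
- by move=> i; exact: measurable_funD.
- by move=> i A mA; exact: lebesgue_measure_shift.
Qed.

Lemma integral_lebesgue_rV_opp (R : realType) (n : nat)
    (f : 'rV[R]_n -> \bar R) :
  measurable_fun setT f -> (forall x, 0 <= f x)%E ->
  (\int[lebesgue_rV n]_x f (- x)%R = \int[lebesgue_rV n]_x f x)%E.
Proof.
move=> mf f0.
rewrite -(@integral_lebesgue_rV_coord _ _ (fun i x => - x) f)//.
- by apply: eq_integral => x _; congr f; apply/rowP => i; rewrite !mxE.
- by move=> i; exact: measurable_funN.
- by move=> i A mA; exact: lebesgue_measureN.
Qed.

Lemma measurable_dotp (R : realType) (n : nat) (c : 'rV[R]_n) :
  measurable_fun [set: 'rV[R]_n] (dotp c).
Proof.
apply: measurable_sum => i; apply: measurable_funM => //.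
exact: measurable_coor.
Qed.

Lemma measurable_level (d : measure_display) (T : measurableType d)
    (R : realType) (f : T -> R) (t : R) :
  measurable_fun setT f -> measurable [set x | f x = t].
Proof.
move=> mf; rewrite -[X in measurable X]setTI.
exact: (mf measurableT [set t]).
Qed.

(** Induction on the dimension. If the tail of [c] is nonzero, the sections at a
    fixed first coordinate are hyperplanes of one dimension less; otherwise the
    sections at a fixed tail are single points of the line. *)
Lemma lebesgue_rV_hyperplane (R : realType) (n : nat) (c : 'rV[R]_n) (t : R) :
  c != 0 -> lebesgue_rV n [set x | dotp c x = t] = 0%E.
Proof.
elim: n c t => [|n IH] c t c0.
  by move: c0; rewrite (_ : c = 0) ?eqxx//; apply/rowP => -[].
have mH : measurable [set x | dotp c x = t].
  by apply: measurable_level; exact: measurable_dotp.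
pose c' : 'rV[R]_n := \row_i c ord0 (lift ord0 i).
have dotpE (x : measurableTypeR R) v :
    dotp c (cons_rV (x, v)) = c ord0 ord0 * (x : R) + dotp c' v.
  rewrite /dotp big_ord_recl cons_rV0; congr (_ + _).
  by apply: eq_bigr => i _; rewrite cons_rVS mxE.
rewrite -[X in lebesgue_rV _ X]setIT -integral_indic// integral_lebesgue_rVS//; last first.
  by apply/measurable_EFinP; exact: measurable_indic.
have [c'0|c'0] := eqVneq c' 0.
  have c00 : c ord0 ord0 != 0.
    apply: contraNneq c0 => c00; apply/eqP/rowP => i.
    case: (unliftP ord0 i) => [j ->|->]; rewrite mxE//.
    by have /rowP/(_ j) := c'0; rewrite !mxE.
  pose g (p : measurableTypeR R * 'rV[R]_n) : \bar R :=
    (\1_[set x | dotp c x = t] (cons_rV p))%:E.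
  have mg : measurable_fun setT g.
    apply/measurable_EFinP.
    exact: (measurableT_comp (measurable_indic mH) (@measurable_cons_rV R n)).
  rewrite (fubini_tonelli g)//; last by move=> p; rewrite lee_fin.
  rewrite integral0_eq// => v _.
  rewrite (_ : (fun x => _) = (fun x => (\1_[set t / c ord0 ord0] x)%:E)).
    by rewrite integral_indic// setIT; exact: lebesgue_measure_set1.
  apply/funext => x.
  have d0 : dotp c' v = 0.
    by rewrite c'0 /dotp big1// => i _; rewrite mxE mul0r.
  rewrite !indicE; congr ((_ : bool)%:R%:E).
  apply/idP/idP; rewrite !inE/= dotpE d0 addr0.
    by move=> <-; rewrite mulrAC divff// mul1r.
  by move=> ->; rewrite mulrC divfK.
rewrite integral0_eq// => x _; apply: etrans (IH c' (t - c ord0 ord0 * x) c'0).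
rewrite -[X in _ = lebesgue_rV _ X]setIT -integral_indic//; last first.
  by apply: measurable_level; exact: measurable_dotp.
apply: eq_integral => v _; rewrite !indicE; congr ((_ : bool)%:R%:E).
apply/idP/idP; rewrite !inE/= dotpE; first by move=> <-; rewrite addrC addKr.
by move=> ->; rewrite addrC subrK.
Qed.

(** * The pointwise inequality *)

Lemma powR_le_mono (R : realType) (s x y : R) :
  0 <= s -> 0 <= x -> x <= y -> x `^ s <= y `^ s.
Proof.
move=> s0 x0 xy; apply: ge0_ler_powR => //; rewrite nnegrE//.
exact: le_trans xy.
Qed.

Lemma powR_lt_mono (R : realType) (s x y : R) :
  0 < s -> 0 <= x -> x < y -> x `^ s < y `^ s.
Proof.
move=> s0 x0 xy; apply: gt0_ltr_powR => //; rewrite nnegrE//.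
exact: le_trans (ltW xy).
Qed.

(** Convexity of the power function at the midpoint. *)
Lemma powR_add_le (R : realType) (s x y : R) : 1 <= s -> 0 <= x -> 0 <= y ->
  (x + y) `^ s <= 2 `^ (s - 1) * (x `^ s + y `^ s).
Proof.
move=> s1 x0 y0.
have h0 : 0 <= (2^-1 : R) by rewrite invr_ge0.
have h1 : (2^-1 : R) <= 1 by rewrite invf_le1 ?ler1n.
have : (2^-1 * x + 2^-1 * y) `^ s <= 2^-1 * x `^ s + 2^-1 * y `^ s.
  rewrite {2 4}(_ : 2^-1 = 1 - 2^-1); last by rewrite {2}(splitr 1) div1r addrK.
  by apply: (convex_powR s1 (Itv01 h0 h1)) => //=; rewrite inE/= in_itv/= andbT.
rewrite -!mulrDr powRM ?addr_ge0//.
have -> : 2^-1 `^ s = (2 `^ s)^-1 :> R.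
  by rewrite -(@powR_inv1 _ 2)// -powRrM mulN1r powRN.
rewrite ler_pdivrMl ?powR_gt0// => /le_trans; apply.
by rewrite mulrA powRD ?powRN ?powRr1//; apply/implyP.
Qed.

(** Cauchy-Schwarz in a form free of divisions: with [p = M / al] and
    [q = M / be] it reads [(A + B)^2 <= (al + be) (A^2 / al + B^2 / be)].
    Multiplying out, the claim reduces to the inequality between the arithmetic
    and geometric means of [be A^2 p] and [al B^2 q], whose product is at least
    [(A B M)^2]. *)
Lemma crossing_mass_le (R : realFieldType) (A B al be p q M : R) :
  0 <= A -> 0 <= B -> 0 <= al -> 0 <= be -> 0 <= p -> 0 <= q -> 0 <= M ->
  M <= al * p -> M <= be * q ->
  (A + B) ^+ 2 * M <= (al + be) * (A ^+ 2 * p + B ^+ 2 * q).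
Proof.
move=> A0 B0 al0 be0 p0 q0 M0 Mp Mq.
have uv : A ^+ 2 * B ^+ 2 * M ^+ 2 <= (be * (A ^+ 2 * p)) * (al * (B ^+ 2 * q)).
  rewrite [leRHS](_ : _ = A ^+ 2 * B ^+ 2 * ((al * p) * (be * q))); last by ring.
  by rewrite ler_wpM2l ?mulr_ge0 ?sqr_ge0// expr2 ler_pM.
have AB : 2 * (A * B * M) <= be * (A ^+ 2 * p) + al * (B ^+ 2 * q).
  set u := be * _ in uv *; set v := al * _ in uv *.
  have u0 : 0 <= u by rewrite !mulr_ge0 ?sqr_ge0.
  have v0 : 0 <= v by rewrite !mulr_ge0 ?sqr_ge0.
  rewrite -(@ler_pXn2r _ 2) ?nnegrE ?addr_ge0 ?mulr_ge0 ?ler0n//.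
  have := sqr_ge0 (u - v); nra.
have H1 : 0 <= A ^+ 2 * (al * p - M) by rewrite mulr_ge0 ?sqr_ge0 ?subr_ge0.
have H2 : 0 <= B ^+ 2 * (be * q - M) by rewrite mulr_ge0 ?sqr_ge0 ?subr_ge0.
nra.
Qed.

(** The equality case of Cauchy-Schwarz forces [be A = al B]. *)
Lemma crossing_mass_lt (R : realFieldType) (A B al be p q M : R) :
  0 < A -> 0 < B -> 0 <= al -> 0 <= be -> 0 <= p -> 0 <= q -> 0 <= M ->
  M <= al * p -> M <= be * q ->
  be * A != al * B ->
  0 < (al + be) * (A ^+ 2 * p + B ^+ 2 * q) ->
  (A + B) ^+ 2 * M < (al + be) * (A ^+ 2 * p + B ^+ 2 * q).
Proof.
move=> A0 B0 al0 be0 p0 q0 M0 Mp Mq neq G0.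
rewrite lt_neqAle crossing_mass_le ?andbT// 1?ltW//.
apply/eqP => E.
have M1 : 0 < M.
  rewrite lt_neqAle M0 andbT; apply/eqP => M00.
  by move: G0; rewrite -E -M00 mulr0 ltxx.
have al1 : 0 < al.
  rewrite lt_neqAle al0 andbT; apply/eqP => Z.
  by move: Mp; rewrite -Z mul0r leNgt M1.
have be1 : 0 < be.
  rewrite lt_neqAle be0 andbT; apply/eqP => Z.
  by move: Mq; rewrite -Z mul0r leNgt M1.
have pM : M / al <= p by rewrite ler_pdivrMr// mulrC.
have qM : M / be <= q by rewrite ler_pdivrMr// mulrC.
have : (al + be) * (A ^+ 2 * (M / al) + B ^+ 2 * (M / be)) <= (A + B) ^+ 2 * M.
  rewrite E ler_wpM2l ?addr_ge0//.
  by rewrite lerD// ler_wpM2l// sqr_ge0.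
rewrite leNgt => /negP; apply.
rewrite -subr_gt0.
have -> : (al + be) * (A ^+ 2 * (M / al) + B ^+ 2 * (M / be)) - (A + B) ^+ 2 * M =
  (be * A - al * B) ^+ 2 * M / (al * be).
  by field; rewrite !gt_eqF.
apply: divr_gt0; apply: mulr_gt0 => //.
by rewrite exprn_even_gt0//= subr_eq0.
Qed.

(** The charge for a pair of points at signed distances [a] and [a + t] from
    the level [m], joined by steps of weights [al] (forward) and [be] (backward)
    and carrying masses [p] and [q]. A point is charged only if the step towards
    the other one starts in the direction of the level. For a fixed step
    direction every point is therefore charged for at most one of its two
    neighbours, which is where the factor 2 over the plain convexity bound is
    saved. *)
Definition crossing_bound (R : realType) (r a t al be p q : R) : R :=
  2 `^ (r - 2) * ((al + be) *
    ((if a * t < 0 then `|a| `^ r * p else 0) +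
     (if 0 < (a + t) * t then `|a + t| `^ r * q else 0))).

Lemma powR_sqr_half (R : realType) (r x : R) : 0 <= x ->
  x `^ r = (x `^ (r / 2)) ^+ 2.
Proof. by move=> x0; rewrite -powR_mulrn ?powR_ge0// -powRrM divfK. Qed.

(** Convexity of the power [r / 2], then squared: this is the step that requires
    [2 <= r]. *)
Lemma powR_add_le_sqr (R : realType) (r x y : R) : 2 <= r -> 0 <= x -> 0 <= y ->
  (x + y) `^ r <= 2 `^ (r - 2) * (x `^ (r / 2) + y `^ (r / 2)) ^+ 2.
Proof.
move=> r2 x0 y0.
rewrite powR_sqr_half ?addr_ge0// [2 `^ _]powR_sqr_half// -exprMn.
rewrite ler_pXn2r ?nnegrE ?mulr_ge0 ?addr_ge0 ?powR_ge0//.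
rewrite (_ : (r - 2) / 2 = r / 2 - 1); last by lra.
by apply: powR_add_le => //; lra.
Qed.

(** If the step does not jump over the level, the farther of the two points is
    at distance at least the length [x] of the step, and it pays alone; only
    [1 <= 2 `^ (r - 2)] is then needed. *)
Lemma one_sided_le (R : realType) (r x z al be p M : R) : 2 <= r ->
  0 <= x -> x <= z -> 0 <= al -> 0 <= be -> 0 <= p -> M <= al * p ->
  x `^ r * M <= 2 `^ (r - 2) * ((al + be) * (z `^ r * p)).
Proof.
move=> r2 x0 xz al0 be0 p0 Mp.
have h1 : 1 <= 2 `^ (r - 2) :> R.
  by rewrite -[leLHS](powRr0 2) ler_powR ?ler1n// subr_ge0.
have h2 : x `^ r <= z `^ r by apply: powR_le_mono => //; lra.
have hx : 0 <= x `^ r by exact: powR_ge0.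
have h3 : x `^ r * M <= z `^ r * (al * p).
  apply: (@le_trans _ _ (x `^ r * (al * p))); first by rewrite ler_wpM2l.
  by rewrite ler_wpM2r// mulr_ge0.
apply: (le_trans h3).
have h4 : 0 <= (al + be) * (z `^ r * p).
  by rewrite !mulr_ge0 ?addr_ge0 ?powR_ge0.
have h5 : z `^ r * (al * p) <= (al + be) * (z `^ r * p).
  rewrite [leLHS](_ : _ = al * (z `^ r * p)); last by ring.
  by rewrite ler_wpM2r ?lerDl// mulr_ge0 ?powR_ge0.
by apply: (le_trans h5); rewrite ler_peMl.
Qed.

Lemma one_sided_lt (R : realType) (r x z al be p M : R) : 2 <= r ->
  0 <= x -> x < z -> 0 <= al -> 0 <= be -> 0 <= p -> M <= al * p ->
  0 < 2 `^ (r - 2) * ((al + be) * (z `^ r * p)) ->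
  x `^ r * M < 2 `^ (r - 2) * ((al + be) * (z `^ r * p)).
Proof.
move=> r2 x0 xz al0 be0 p0 Mp G0.
apply: (le_lt_trans (one_sided_le r2 x0 (lexx x) al0 be0 p0 Mp)).
rewrite ltr_pM2l ?powR_gt0//.
move: G0; rewrite pmulr_rgt0 ?powR_gt0// => G0.
have ab : 0 < al + be.
  rewrite lt_neqAle addr_ge0// andbT; apply/eqP => Z.
  by move: G0; rewrite -Z mul0r ltxx.
rewrite ltr_pM2l//.
move: G0; rewrite pmulr_rgt0// => G0.
have p1 : 0 < p.
  rewrite lt_neqAle p0 andbT; apply/eqP => Z.
  by move: G0; rewrite -Z mulr0 ltxx.
by rewrite ltr_pM2r//; apply: powR_lt_mono => //; lra.
Qed.

Lemma norm_step_across (R : realDomainType) (a t : R) :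
  a * t < 0 -> 0 < (a + t) * t -> `|t| = `|a| + `|a + t|.
Proof.
move=> at0 bt0.
have [t0|t0|t0] := ltrgt0P t; last by move: at0; rewrite t0 mulr0 ltxx.
  have a0 : a < 0 by rewrite -(pmulr_llt0 _ t0).
  have b0 : 0 < a + t by rewrite -(pmulr_lgt0 _ t0).
  by rewrite (ltr0_norm a0) (gtr0_norm b0) addKr.
have a0 : 0 < a by rewrite -(nmulr_llt0 _ t0).
have b0 : a + t < 0 by rewrite -(nmulr_lgt0 _ t0).
by rewrite (gtr0_norm a0) (ltr0_norm b0); lra.
Qed.

(** If the step jumps over the level its length is the sum of the two distances
    and both points pay, with Cauchy-Schwarz; otherwise the farther one pays. *)
Lemma crossing_le (R : realType) (r a t al be p q : R) : 2 <= r ->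
  0 <= al -> 0 <= be -> 0 <= p -> 0 <= q ->
  `|t| `^ r * Num.min (al * p) (be * q) <= crossing_bound r a t al be p q.
Proof.
move=> r2 al0 be0 p0 q0; rewrite /crossing_bound.
set M := Num.min _ _.
have Mp : M <= al * p by rewrite /M ge_min lexx.
have Mq : M <= be * q by rewrite /M ge_min lexx orbT.
have M0 : 0 <= M by rewrite /M le_min !mulr_ge0.
have [at0|at0] := ltP (a * t) 0; have [bt0|bt0] := ltP 0 ((a + t) * t).
- rewrite (norm_step_across at0 bt0).
  apply: (@le_trans _ _
    (2 `^ (r - 2) * (`|a| `^ (r / 2) + `|a + t| `^ (r / 2)) ^+ 2 * M)).
    by rewrite ler_wpM2r// powR_add_le_sqr.
  rewrite -mulrA ler_wpM2l ?powR_ge0// !(@powR_sqr_half _ r)//.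
  by apply: crossing_mass_le; rewrite ?powR_ge0.
- rewrite addr0; apply: one_sided_le => //.
  rewrite -(@ler_pXn2r _ 2) ?nnegrE ?normr_ge0// !real_normK ?num_real//.
  have := sqr_ge0 (a + t); nra.
- rewrite add0r [al + be]addrC; apply: one_sided_le => //.
  rewrite -(@ler_pXn2r _ 2) ?nnegrE ?normr_ge0// !real_normK ?num_real//.
  have := sqr_ge0 a; nra.
- have -> : t = 0 by apply/eqP; rewrite -sqrf_eq0; apply/eqP; have := sqr_ge0 t; nra.
  by rewrite normr0 powR0 ?mul0r ?addr0 ?mulr0//; lra.
Qed.

(** The starting offset for which the distances [A], [B] to the level, raised to
    the power [r / 2], satisfy the equality condition [be A = al B]. *)
Definition balance_point (R : realType) (r t al be : R) : R :=
  - (al / be) `^ (2 / r) * t / (1 + (al / be) `^ (2 / r)).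

Lemma crossing_lt (R : realType) (r a t al be p q : R) : 2 <= r ->
  0 <= al -> 0 <= be -> 0 <= p -> 0 <= q ->
  a != 0 -> a + t != 0 -> a != balance_point r t al be ->
  0 < crossing_bound r a t al be p q ->
  `|t| `^ r * Num.min (al * p) (be * q) < crossing_bound r a t al be p q.
Proof.
move=> r2 al0 be0 p0 q0 a0 b0 abal; rewrite /crossing_bound.
set M := Num.min _ _.
have Mp : M <= al * p by rewrite /M ge_min lexx.
have Mq : M <= be * q by rewrite /M ge_min lexx orbT.
have M0 : 0 <= M by rewrite /M le_min !mulr_ge0.
have [at0|at0] := ltP (a * t) 0; have [bt0|bt0] := ltP 0 ((a + t) * t).
- have tE := norm_step_across at0 bt0.
  move=> G0.
  apply: (@le_lt_trans _ _
    (2 `^ (r - 2) * (`|a| `^ (r / 2) + `|a + t| `^ (r / 2)) ^+ 2 * M)).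
    by rewrite tE ler_wpM2r// powR_add_le_sqr.
  move: G0; rewrite -mulrA ltr_pM2l ?powR_gt0// !(@powR_sqr_half _ r)//.
  rewrite pmulr_rgt0 ?powR_gt0// => G0.
  apply: crossing_mass_lt; rewrite ?powR_ge0 ?powR_gt0 ?normr_gt0//.
  (* With [A = |a|^(r/2)] and [B = |a + t|^(r/2)], tightness means [be A = al B],
     that is [|a| = k |a + t|]; as [a] and [a + t] have opposite signs, [a] is
     determined by [t]. *)
  apply: contra abal => /eqP AB; apply/eqP.
  have B0 : 0 < `|a + t| `^ (r / 2) by rewrite powR_gt0 ?normr_gt0.
  have be1 : 0 < be.
    rewrite lt_neqAle be0 andbT; apply/eqP => be00.
    move/eqP: AB; rewrite -be00 mul0r eq_sym mulf_eq0 (gt_eqF B0) orbF => /eqP al00.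
    by move: G0; rewrite -be00 al00 addr0 mul0r ltxx.
  have cancel_half x : 0 <= x -> (x `^ (r / 2)) `^ (2 / r) = x.
    move=> x0; rewrite -powRrM (_ : r / 2 * (2 / r) = 1) ?powRr1//.
    by field; lra.
  rewrite /balance_point; set k := (al / be) `^ (2 / r).
  have k0 : 0 <= k by exact: powR_ge0.
  have ak : `|a| = k * `|a + t|.
    rewrite -(cancel_half `|a|)// -(cancel_half `|a + t|)// /k -powRM ?divr_ge0 ?powR_ge0//.
    by congr (_ `^ _); rewrite mulrAC -AB mulrAC divff ?mul1r// gt_eqF.
  have {}ak : a = - k * (a + t).
    have [t0|t0|t0] := ltrgt0P t; last by move: at0; rewrite t0 mulr0 ltxx.
      have a1 : a < 0 by rewrite -(pmulr_llt0 _ t0).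
      have b1 : 0 < a + t by rewrite -(pmulr_lgt0 _ t0).
      by move: ak; rewrite (ltr0_norm a1) (gtr0_norm b1); lra.
    have a1 : 0 < a by rewrite -(nmulr_llt0 _ t0).
    have b1 : a + t < 0 by rewrite -(nmulr_lgt0 _ t0).
    by move: ak; rewrite (gtr0_norm a1) (ltr0_norm b1); lra.
  have k1 : 1 + k != 0 by rewrite gt_eqF// ltr_wpDr.
  by apply: (mulIf k1); rewrite divfK//; lra.
- rewrite addr0 => G0; apply: one_sided_lt => //.
  rewrite -(@ltr_pXn2r _ 2) ?nnegrE ?normr_ge0// !real_normK ?num_real//.
  have : 0 < (a + t) ^+ 2 by rewrite exprn_even_gt0.
  nra.
- rewrite add0r [al + be]addrC => G0; apply: one_sided_lt => //.
  rewrite -(@ltr_pXn2r _ 2) ?nnegrE ?normr_ge0// !real_normK ?num_real//.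
  have : 0 < a ^+ 2 by rewrite exprn_even_gt0.
  nra.
- by rewrite addr0 !mulr0 ltxx.
Qed.

(** * Strict comparison of integrals *)

Lemma measurable_tight (d : measure_display) (T : measurableType d)
    (R : realType) (F G : T -> R) :
  measurable_fun setT F -> measurable_fun setT G ->
  measurable [set x | F x = G x /\ 0 < G x].
Proof.
move=> mF mG.
rewrite (_ : [set _ | _] = [set x | F x - G x = 0] `&` (G @^-1` `]0, +oo[)).
  apply: measurableI; first by apply: measurable_level; exact: measurable_funB.
  by rewrite -[X in measurable X]setTI; exact: mG.
apply/seteqP; split => x /=; rewrite in_itv/= andbT.
  by case=> -> ->; rewrite subrr.
by case=> /eqP; rewrite subr_eq0 => /eqP -> ->.
Qed.

(** If the integrals of [F] and [G] coincide, then [F = G] almost everywhere, so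
    [G = 0] almost everywhere since the points with [F = G > 0] are negligible;
    the integral of [F] is then 0, which is below the positive bound [C]. *)
Lemma integral_lt_bound (d : measure_display) (T : measurableType d)
    (R : realType) (mu : {measure set T -> \bar R}) (F G : T -> R) (C : \bar R) :
  measurable_fun setT F -> measurable_fun setT G ->
  (forall x, 0 <= F x) -> (forall x, F x <= G x) ->
  mu [set x | F x = G x /\ 0 < G x] = 0%E ->
  (\int[mu]_x (G x)%:E <= C)%E -> (0 < C)%E -> (C < +oo)%E ->
  (\int[mu]_x (F x)%:E < C)%E.
Proof.
move=> mF mG F0 FG N0 GC C0 Coo.
have mH : measurable_fun setT (fun x => G x - F x) by exact: measurable_funB.
have mHE : measurable_fun setT (fun x => (G x - F x)%:E) by exact/measurable_EFinP.
have mFE : measurable_fun setT (fun x => (F x)%:E) by exact/measurable_EFinP.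
have H0 x : 0 <= G x - F x by rewrite subr_ge0.
have GE : (\int[mu]_x (G x)%:E = \int[mu]_x (F x)%:E + \int[mu]_x (G x - F x)%:E)%E.
  rewrite -ge0_integralD//; last 2 first.
  - by move=> x _; rewrite lee_fin.
  - by move=> x _; rewrite lee_fin.
  by apply: eq_integral => x _; rewrite -EFinD addrC subrK.
have iF0 : (0 <= \int[mu]_x (F x)%:E)%E.
  by apply: integral_ge0 => x _; rewrite lee_fin.
have iH0 : (0 <= \int[mu]_x (G x - F x)%:E)%E.
  by apply: integral_ge0 => x _; rewrite lee_fin.
have [Hpos|Hnpos] := ltP 0%E (\int[mu]_x (G x - F x)%:E)%E.
  apply: (lt_le_trans _ GC); rewrite GE lteDl//.
  rewrite ge0_fin_numE//; apply: (le_lt_trans _ Coo); apply: (le_trans _ GC).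
  by rewrite GE leeDl.
have H00 : (\int[mu]_x `|(G x - F x)%:E| = 0)%E.
  apply/eqP; rewrite eq_le; apply/andP; split.
    by under eq_integral do rewrite gee0_abs ?lee_fin//.
  exact: integral_ge0.
have [E [mE E0 HE]] := (ae_eq_integral_abs _ measurableT mHE).1 H00.
suff -> : (\int[mu]_x (F x)%:E = 0)%E by [].
have mN : measurable [set x | F x = G x /\ 0 < G x].
  exact: measurable_tight.
rewrite (@ge0_negligible_integral _ _ _ mu setT (E `|` [set x | F x = G x /\ 0 < G x]))//.
- apply: integral0_eq => x [_ /not_orP[/= xE xN]]; apply/eqP.
  rewrite eqe; apply: contrapT => Fx; apply: xN.
  have FGx : F x = G x.
    apply: contrapT => FGx; apply: xE; apply: HE => /= /(_ I) [] /eqP.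
    by rewrite subr_eq0 => /eqP/esym.
  by split => //; rewrite -FGx lt_neqAle eq_sym F0 andbT; apply/negP.
- exact: measurableU.
- by move=> x _; rewrite lee_fin.
- by apply: null_set_setU.
Qed.

(** * The law of one accept-reject step *)

(** Joint law of one step of a chain that moves with sub-density [k x] and stays
    put with probability the integral of [rho x]. Writing the latter as an
    integral over rejected proposals makes the atom on the diagonal the image
    of an absolutely continuous measure under [(x, y) |-> (x, x)], so the law of
    the pair is a sum of two images of densities; the Markov property gives the
    equality on rectangles. *)
Lemma accept_reject_expectation (dO d : measure_display)
    (Omega : measurableType dO) (T : measurableType d) (R : realType)
    (P : probability Omega R) (L : {sigma_finite_measure set T -> \bar R})
    (X Y : {RV P >-> T}) (f : T -> R) (k rho : T * T -> R)
    (K : T -> set T -> \bar R) :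
  measurable_fun setT f -> (forall x, 0 <= f x) ->
  measurable_fun setT k -> (forall z, 0 <= k z) ->
  measurable_fun setT rho -> (forall z, 0 <= rho z) ->
  (forall x A, measurable A ->
     K x A = \int[L]_(y in A) (k (x, y))%:E +
             (\int[L]_y (rho (x, y))%:E) * \d_x A)%E ->
  (forall A, measurable A ->
     distribution P X A = \int[L]_(x in A) (f x)%:E)%E ->
  (forall A B, measurable A -> measurable B ->
     P (X @^-1` A `&` Y @^-1` B) = \int[P]_(w in X @^-1` A) K (X w) B)%E ->
  forall g : T * T -> R, measurable_fun setT g -> (forall z, 0 <= g z) ->
  (\int[P]_w (g (X w, Y w))%:E =
   \int[L \x L]_z (g z * (f z.1 * k z))%R%:E +
   \int[L \x L]_z (g (z.1, z.1) * (f z.1 * rho z))%R%:E)%E.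
Proof.
move=> mf f0 mk k0 mrho rho0 KE fX XY g mg g0.
have mf1 : measurable_fun setT (fun z : T * T => f z.1).
  exact: (measurableT_comp mf measurable_fst).
have [nuf [nufE nufI]] := density_measure L mf f0.
have [nu1 [nu1E nu1I]] := @density_measure _ _ _ (L \x L)%E (fun z => f z.1 * k z)
  (measurable_funM mf1 mk) (fun z => mulr_ge0 (f0 z.1) (k0 z)).
have [nu2 [nu2E nu2I]] := @density_measure _ _ _ (L \x L)%E (fun z => f z.1 * rho z)
  (measurable_funM mf1 mrho) (fun z => mulr_ge0 (f0 z.1) (rho0 z)).
have mdiag : measurable_fun setT (fun z : T * T => (z.1, z.1)).
  by apply: measurable_fun_pair; exact: measurable_fst.
pose nu2' :=
  measure_function_pushforward__canonical__measure_function_Measure nu2 mdiag.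
have mXY : measurable_fun setT (fun w => (X w, Y w)).
  by apply: measurable_fun_pair.
pose D :=
  measure_function_pushforward__canonical__measure_function_Measure P mXY.
pose nu := measure_add nu1 nu2'.
have indicE' (S : Type) (A : set S) (h : S -> R) :
    ((EFin \o h) \_ A = fun x => (h x * \1_A x)%R%:E)%E.
  by apply/funext => x; rewrite epatch_indic EFinM.
have m1 A : measurable A -> measurable_fun setT (fun z : T * T => \1_A z.1 : R).
  by move=> mA; apply: (measurableT_comp (measurable_indic mA) measurable_fst).
have m2 A : measurable A -> measurable_fun setT (fun z : T * T => \1_A z.2 : R).
  by move=> mA; apply: (measurableT_comp (measurable_indic mA) measurable_snd).
have KE' x A : measurable A -> K x A =
    (\int[L]_y (k (x, y) * \1_A y)%R%:E +
     \int[L]_y (rho (x, y) * \1_A x)%R%:E)%E.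
  move=> mA; rewrite KE//; congr (_ + _)%E.
    by rewrite integral_mkcond -(indicE' _ A (fun y => k (x, y))).
  under [RHS]eq_integral do rewrite EFinM.
  rewrite ge0_integralZr//.
  - exact/measurable_EFinP/(measurableT_comp mrho)/measurable_pair1.
  - by move=> y _; rewrite lee_fin.
have K0 x A : measurable A -> (0 <= K x A)%E.
  by move=> mA; rewrite KE'// adde_ge0// integral_ge0// => y _; rewrite lee_fin mulr_ge0.
have mKE A : measurable A -> measurable_fun setT (K ^~ A).
  move=> mA; under eq_fun do rewrite KE'//.
  apply: emeasurable_funD.
    apply: (measurable_fun_fubini_tonelli_F (fun z => (k z * \1_A z.2)%:E)).
      by apply/measurable_EFinP; apply: measurable_funM => //; exact: m2.
    by move=> z; rewrite lee_fin mulr_ge0.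
  apply: (measurable_fun_fubini_tonelli_F (fun z => (rho z * \1_A z.1)%:E)).
    by apply/measurable_EFinP; apply: measurable_funM => //; exact: m1.
  by move=> z; rewrite lee_fin mulr_ge0.
have DE (C : set (T * T)) : measurable C -> D C = nu C.
  apply: finite_measure_eq_rect => [|A B mA mB].
    by rewrite /D/= /pushforward preimage_setT probability_setT ltry.
  rewrite [RHS](measure_addE nu1 nu2' (A `*` B)).
  rewrite -[X in (_ + X)%E]/(nu2 ((fun z => (z.1, z.1)) @^-1` (A `*` B)))%E.
  rewrite [LHS](_ : _ = \int[P]_(w in X @^-1` A) K (X w) B)%E; last by rewrite -XY.
  transitivity (\int[nuf]_(x in A) K x B)%E.
    rewrite -(ge0_integral_pushforward (measurable_funPT X) P (f := K ^~ B) mA)//.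
    - by apply: eq_measure_integral => E mE _; rewrite nufE -fX.
    - exact: measurable_funTS (mKE _ mB).
    - by move=> x _; exact: K0.
  have mk' x : measurable_fun setT (fun y => (k (x, y) * \1_B y)%:E).
    apply/measurable_EFinP; apply: measurable_funM; last exact: measurable_indic.
    exact/(measurableT_comp mk)/measurable_pair1.
  have mrho' x : measurable_fun setT (fun y => (rho (x, y) * \1_B x)%:E).
    apply/measurable_EFinP; apply: measurable_funM => //.
    exact/(measurableT_comp mrho)/measurable_pair1.
  have k0' x y : (0 <= (k (x, y) * \1_B y)%:E)%E by rewrite lee_fin mulr_ge0.
  have rho0' x y : (0 <= (rho (x, y) * \1_B x)%:E)%E by rewrite lee_fin mulr_ge0.
  have I0 x : (0 <= (\1_A x * f x)%:E)%E by rewrite lee_fin mulr_ge0.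
  rewrite integral_mkcond epatch_indic nufI; first last.
  - by move=> x; rewrite mule_ge0// ?K0// lee_fin.
  - by apply: emeasurable_funM; [exact: mKE|apply/measurable_EFinP; exact: measurable_indic].
  transitivity (\int[L]_x (\int[L]_y ((k (x, y) * \1_B y) * (\1_A x * f x))%R%:E +
                           \int[L]_y ((rho (x, y) * \1_B x) * (\1_A x * f x))%R%:E))%E.
    apply: eq_integral => x _; rewrite KE'// -muleA -EFinM ge0_muleDl ?integral_ge0//.
    by congr (_ + _)%E; under [RHS]eq_integral do rewrite EFinM;
      rewrite ge0_integralZr.
  pose h1 z : \bar R := ((k z * \1_B z.2) * (\1_A z.1 * f z.1))%:E.
  pose h2 z : \bar R := ((rho z * \1_B z.1) * (\1_A z.1 * f z.1))%:E.
  have mh1 : measurable_fun setT h1.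
    apply/measurable_EFinP; apply: measurable_funM; apply: measurable_funM => //;
      [exact: m2|exact: m1].
  have mh2 : measurable_fun setT h2.
    apply/measurable_EFinP; apply: measurable_funM; apply: measurable_funM => //; exact: m1.
  have h10 z : (0 <= h1 z)%E by rewrite lee_fin !mulr_ge0.
  have h20 z : (0 <= h2 z)%E by rewrite lee_fin !mulr_ge0.
  rewrite ge0_integralD//; last 4 first.
  - by move=> x _; apply: integral_ge0 => y _; exact: h10.
  - exact: (measurable_fun_fubini_tonelli_F h1).
  - by move=> x _; apply: integral_ge0 => y _; exact: h20.
  - exact: (measurable_fun_fubini_tonelli_F h2).
  rewrite -(fubini_tonelli1 h1)// -(fubini_tonelli1 h2)//.
  rewrite nu1E nu2E; congr (_ + _)%E; rewrite [RHS]integral_mkcond.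
    rewrite (indicE' _ _ (fun z : T * T => f z.1 * k z)).
    apply: eq_integral => -[x y] _; congr (_%:E) => /=.
    have -> : \1_(A `*` B) (x, y) = \1_A x * \1_B y :> R.
      rewrite !indicE -natrM mulnb; congr (nat_of_bool _)%:R.
      by apply/idP/andP; rewrite !inE.
    by rewrite -!mulrA; ring.
  rewrite (indicE' _ _ (fun z : T * T => f z.1 * rho z)).
  apply: eq_integral => -[x y] _; congr (_%:E) => /=.
  have -> : \1_((fun z : T * T => (z.1, z.1)) @^-1` (A `*` B)) (x, y) =
      \1_A x * \1_B x :> R.
    rewrite !indicE -natrM mulnb; congr (nat_of_bool _)%:R.
    by apply/idP/andP; rewrite !inE.
  by rewrite -!mulrA; ring.
have mgE : measurable_fun setT (EFin \o g) by exact/measurable_EFinP.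
transitivity (\int[D]_z (g z)%:E)%E.
  by rewrite ge0_integral_pushforward// => z _; rewrite lee_fin.
transitivity (\int[nu]_z (g z)%:E)%E.
  by apply: eq_measure_integral => C mC _; exact: DE.
rewrite ge0_integral_measure_add//; last by move=> z _; rewrite lee_fin.
congr (_ + _)%E.
  by rewrite nu1I.
rewrite ge0_integral_pushforward//; last by move=> z _; rewrite lee_fin.
rewrite preimage_setT nu2I//.
- exact: (measurableT_comp mgE mdiag).
- by move=> z; rewrite lee_fin.
Qed.

(** * The accepted flow of the random walk Metropolis chain *)

Section measurable_rV_ops.
Context {d : measure_display} {T : measurableType d} {R : realType} {n : nat}.
Implicit Types f g : T -> 'rV[R]_n.

Lemma measurable_rVD f g : measurable_fun setT f -> measurable_fun setT g ->
  measurable_fun setT (fun x => f x + g x).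
Proof.
move=> /measurable_fun_rVP mf /measurable_fun_rVP mg.
by apply/measurable_fun_rVP => i; under eq_fun do rewrite mxE; exact: measurable_funD.
Qed.

Lemma measurable_rVN f : measurable_fun setT f -> measurable_fun setT (fun x => - f x).
Proof.
move=> /measurable_fun_rVP mf.
by apply/measurable_fun_rVP => i; under eq_fun do rewrite mxE; exact: measurable_funN.
Qed.

Lemma measurable_rVB f g : measurable_fun setT f -> measurable_fun setT g ->
  measurable_fun setT (fun x => f x - g x).
Proof. by move=> mf mg; apply: measurable_rVD => //; exact: measurable_rVN. Qed.

End measurable_rV_ops.

Section rwmh_density.
Context {R : realType} {d : nat}.
Variables pi phi : 'rV[R]_d -> R.
Hypotheses (mpi : measurable_fun setT pi) (pi0 : forall x, 0 <= pi x).
Hypotheses (mphi : measurable_fun setT phi) (phi0 : forall x, 0 <= phi x).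

Lemma measurable_rw_proposal (dT : measure_display) (T : measurableType dT)
    (f g : T -> 'rV[R]_d) : measurable_fun setT f -> measurable_fun setT g ->
  measurable_fun setT (fun x => rw_proposal phi (f x) (g x)).
Proof. by move=> mf mg; apply: (measurableT_comp mphi); exact: measurable_rVB. Qed.

Let flow_ge0 x y : 0 <= pi x * rw_proposal phi x y.
Proof. by apply: mulr_ge0 => //; exact: phi0. Qed.

Lemma measurable_acceptance :
  measurable_fun setT (fun z : 'rV[R]_d * 'rV[R]_d => acceptance pi phi z.1 z.2).
Proof.
have mD : measurable_fun setT
    (fun z : 'rV[R]_d * 'rV[R]_d => pi z.1 * rw_proposal phi z.1 z.2).
  apply: measurable_funM; first exact: (measurableT_comp mpi measurable_fst).
  by apply: measurable_rw_proposal.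
have mN : measurable_fun setT
    (fun z : 'rV[R]_d * 'rV[R]_d => pi z.2 * rw_proposal phi z.2 z.1).
  apply: measurable_funM; first exact: (measurableT_comp mpi measurable_snd).
  by apply: measurable_rw_proposal.
rewrite /acceptance; apply: measurable_fun_ifT => //.
  exact: measurable_fun_ltr.
apply: measurable_minr => //; apply: measurable_funM => //.
have DV (z : 'rV[R]_d * 'rV[R]_d) : (pi z.1 * rw_proposal phi z.1 z.2)^-1 =
    (pi z.1 * rw_proposal phi z.1 z.2) `^ (-1).
  by rewrite powR_inv1.
under eq_fun do rewrite DV.
exact: (measurableT_comp (measurable_powR (- 1)) mD).
Qed.

Lemma acceptance_ge0 x y : 0 <= acceptance pi phi x y.
Proof.
rewrite /acceptance; case: ifP => // _.
by rewrite le_min ler01/= divr_ge0.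
Qed.

Lemma acceptance_le1 x y : acceptance pi phi x y <= 1.
Proof. by rewrite /acceptance; case: ifP => // _; rewrite ge_min lexx. Qed.

(** Detailed balance: the accepted flow is symmetric in [x] and [y]. *)
Lemma accepted_flow x y : pi x * (acceptance pi phi x y * rw_proposal phi x y) =
  Num.min (pi x * rw_proposal phi x y) (pi y * rw_proposal phi y x).
Proof.
rewrite mulrCA /acceptance; case: ltP => [D1|D1].
  by rewrite minr_pMl// mul1r divfK// gt_eqF.
have -> : pi x * rw_proposal phi x y = 0 by apply/eqP; rewrite eq_le D1 flow_ge0.
by rewrite mulr0 min_l.
Qed.

(** Rejected proposals do not contribute since [h 0 = 0]; the rest is detailed
    balance, and the substitution [y = x + s] by translation invariance. *)
Lemma rwmh_increment_expectation (dO : measure_display)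
    (Omega : measurableType dO) (P : probability Omega R)
    (X : nat -> {RV P >-> 'rV[R]_d}) (h : 'rV[R]_d -> R) :
  stationary_rwmh pi phi X ->
  measurable_fun setT h -> (forall s, 0 <= h s) -> h 0 = 0 ->
  (\int[P]_w (h (X 1%N w - X 0%N w))%:E =
   \int[lebesgue_rV d \x lebesgue_rV d]_z
     (h z.2 * Num.min (phi z.2 * pi z.1) (phi (- z.2) * pi (z.1 + z.2)))%R%:E)%E.
Proof.
move=> [Xpi XM] mh h0 h00.
set V : measurableType _ := 'rV[R]_d.
pose k (z : V * V) := acceptance pi phi z.1 z.2 * rw_proposal phi z.1 z.2.
pose rho (z : V * V) := (1 - acceptance pi phi z.1 z.2) * rw_proposal phi z.1 z.2.
pose g (z : V * V) := h (z.2 - z.1).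
have mq : measurable_fun setT (fun z : V * V => rw_proposal phi z.1 z.2).
  by apply: measurable_rw_proposal.
have mk : measurable_fun setT k by apply: measurable_funM => //; exact: measurable_acceptance.
have mrho : measurable_fun setT rho.
  apply: measurable_funM => //; apply: measurable_funB => //; exact: measurable_acceptance.
have k0 z : 0 <= k z by rewrite mulr_ge0 ?acceptance_ge0// phi0.
have rho0 z : 0 <= rho z by rewrite mulr_ge0 ?subr_ge0 ?acceptance_le1// phi0.
have mg : measurable_fun setT g by apply: (measurableT_comp mh); exact: measurable_rVB.
have g0 z : 0 <= g z by exact: h0.
have := @accept_reject_expectation _ _ _ _ _ P (lebesgue_rV d) (X 0%N) (X 1%N) pi k rho
  (rwmh_kernel pi phi) mpi pi0 mk k0 mrho rho0.
move=> /(_ _ Xpi _ g mg g0) -> //; last first.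
  move=> A B mA mB; apply: (XM 0%N) => //.
  apply: sub_sigma_algebra => /=.
  rewrite -bigcup_seq/=; exists ord0 => /=; first by rewrite mem_index_enum.
  by exists A => //; rewrite setTI.
rewrite [X in (_ + X)%E]integral0_eq ?adde0; last first.
  by move=> z _; rewrite /g/= subrr h00 mul0r.
pose F (z : V * V) : \bar R := (g z * (pi z.1 * k z))%:E.
pose F' (z : V * V) : \bar R :=
  (h z.2 * Num.min (phi z.2 * pi z.1) (phi (- z.2) * pi (z.1 + z.2)))%:E.
have mF : measurable_fun setT F.
  apply/measurable_EFinP; apply: measurable_funM => //; apply: measurable_funM => //.
  exact: (measurableT_comp mpi measurable_fst).
have F0 z : (0 <= F z)%E.
  by rewrite lee_fin mulr_ge0 ?g0// mulr_ge0 ?pi0 ?k0.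
have mF' : measurable_fun setT F'.
  apply/measurable_EFinP; apply: measurable_funM.
    exact: (measurableT_comp mh measurable_snd).
  apply: measurable_minr; apply: measurable_funM.
  - exact: (measurableT_comp mphi measurable_snd).
  - exact: (measurableT_comp mpi measurable_fst).
  - by apply: (measurableT_comp mphi); exact: measurable_rVN.
  - by apply: (measurableT_comp mpi); exact: measurable_rVD.
have F'0 z : (0 <= F' z)%E by rewrite lee_fin mulr_ge0 ?h0// le_min !mulr_ge0 ?pi0 ?phi0.
rewrite -[LHS]/(\int[_]_z F z)%E -[RHS]/(\int[_]_z F' z)%E.
rewrite (fubini_tonelli1 F)// (fubini_tonelli1 F')//.
apply: eq_integral => x _; rewrite /fubini_F.
rewrite -(@integral_lebesgue_rV_shift _ _ x (fun y => F (x, y)))//; last first.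
  exact: (measurableT_comp mF (measurable_pair1 x)).
apply: eq_integral => s _; rewrite /F /F' /g /k/= addrK accepted_flow.
by rewrite /rw_proposal addrK opprD addrCA subrr addr0 ![pi _ * _]mulrC [s + x]addrC.
Qed.

End rwmh_density.

(** * Integrating the pointwise inequality *)

Lemma expectation_density (dO d : measure_display) (Omega : measurableType dO)
    (T : measurableType d) (R : realType) (P : probability Omega R)
    (L : {measure set T -> \bar R}) (X : {RV P >-> T}) (f : T -> R) :
  measurable_fun setT f -> (forall x, 0 <= f x) ->
  (forall A, measurable A -> distribution P X A = \int[L]_(x in A) (f x)%:E)%E ->
  forall h : T -> R, measurable_fun setT h -> (forall x, 0 <= h x) ->
  (\int[P]_w (h (X w))%:E = \int[L]_x (h x * f x)%R%:E)%E.
Proof.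
move=> mf f0 fX h mh h0; have [nu [nuE nuI]] := density_measure L mf f0.
have mhE : measurable_fun setT (EFin \o h) by exact/measurable_EFinP.
have hE0 x : (0 <= (EFin \o h) x)%E by rewrite lee_fin.
transitivity (\int[distribution P X]_x (EFin \o h) x)%E.
  by rewrite ge0_integral_pushforward.
transitivity (\int[nu]_x (EFin \o h) x)%E.
  by apply: eq_measure_integral => A mA _; rewrite nuE -fX.
by rewrite nuI.
Qed.

Section crossing_integral.
Context {R : realType} {d : nat}.
Variables (pi phi : 'rV[R]_d -> R) (c : 'rV[R]_d) (r m : R).
Hypotheses (mpi : measurable_fun setT pi) (pi0 : forall x, 0 <= pi x).
Hypotheses (mphi : measurable_fun setT phi) (phi0 : forall x, 0 <= phi x).
Hypothesis phi1 : (\int[lebesgue_rV d]_x (phi x)%:E = 1)%E.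
Hypotheses (r2 : 2 <= r) (c0 : c != 0).
Local Notation V := 'rV[R]_d.

(** In both definitions [z] is a pair (state, step). *)
Definition flow_bound (z : V * V) : R :=
  crossing_bound r (dotp c z.1 - m) (dotp c z.2)
    (phi z.2) (phi (- z.2)) (pi z.1) (pi (z.1 + z.2)).

Definition flow (z : V * V) : R :=
  `|dotp c z.2| `^ r *
    Num.min (phi z.2 * pi z.1) (phi (- z.2) * pi (z.1 + z.2)).

Lemma dotpD x y : dotp c (x + y) = dotp c x + dotp c y.
Proof.
by rewrite /dotp -big_split/=; apply: eq_bigr => i _; rewrite mxE mulrDr.
Qed.

Let mdotp1 : measurable_fun setT (fun z : V * V => dotp c z.1).
Proof. exact: (measurableT_comp (measurable_dotp c) measurable_fst). Qed.

Let mdotp2 : measurable_fun setT (fun z : V * V => dotp c z.2).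
Proof. exact: (measurableT_comp (measurable_dotp c) measurable_snd). Qed.

Let mpi1 : measurable_fun setT (fun z : V * V => pi z.1).
Proof. exact: (measurableT_comp mpi measurable_fst). Qed.

Let mphi2 : measurable_fun setT (fun z : V * V => phi z.2).
Proof. exact: (measurableT_comp mphi measurable_snd). Qed.

Let mphiN : measurable_fun setT (fun z : V * V => phi (- z.2)).
Proof. by apply: (measurableT_comp mphi); exact: measurable_rVN. Qed.

Let mpiD : measurable_fun setT (fun z : V * V => pi (z.1 + z.2)).
Proof. by apply: (measurableT_comp mpi); exact: measurable_rVD. Qed.

Lemma measurable_absR_powR (dT : measure_display) (T : measurableType dT) (f : T -> R) :
  measurable_fun setT f -> measurable_fun setT (fun x => `|f x| `^ r).
Proof.
move=> mf; apply: (measurableT_comp (measurable_powR r)).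
exact: (measurableT_comp (@normr_measurable R setT) mf).
Qed.

Lemma measurable_flow : measurable_fun setT flow.
Proof.
apply: measurable_funM; first exact: measurable_absR_powR.
by apply: measurable_minr; exact: measurable_funM.
Qed.

Lemma measurable_flow_bound : measurable_fun setT flow_bound.
Proof.
have ma : measurable_fun setT (fun z : V * V => dotp c z.1 - m) by exact: measurable_funB.
have mb : measurable_fun setT (fun z : V * V => dotp c z.1 - m + dotp c z.2).
  exact: measurable_funD.
apply: measurable_funM => //; apply: measurable_funM; first exact: measurable_funD.
apply: measurable_funD; apply: measurable_fun_ifT => //.
- by apply: measurable_fun_ltr => //; exact: measurable_funM.
- by apply: measurable_funM => //; exact: measurable_absR_powR.
- by apply: measurable_fun_ltr => //; exact: measurable_funM.
- by apply: measurable_funM => //; exact: measurable_absR_powR.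
Qed.

Lemma flow_ge0 z : 0 <= flow z.
Proof. by rewrite /flow mulr_ge0 ?powR_ge0// le_min !mulr_ge0 ?pi0 ?phi0. Qed.

Lemma flow_le z : flow z <= flow_bound z.
Proof. by apply: crossing_le; rewrite ?pi0 ?phi0. Qed.

(** For a fixed step, the exceptional offsets of the pointwise inequality are
    three values of [dotp c x], hence three null hyperplanes of states. *)
Lemma flow_tight_null :
  (lebesgue_rV d \x lebesgue_rV d)%E [set z | flow z = flow_bound z /\ 0 < flow_bound z] = 0%E.
Proof.
set N := [set z | _].
have mN : measurable N.
  exact: measurable_tight measurable_flow measurable_flow_bound.
have mI : measurable_fun setT (fun z => (\1_N z)%:E : \bar R).
  by apply/measurable_EFinP; exact: measurable_indic.
rewrite -[X in (_ \x _)%E X]setIT -integral_indic//.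
rewrite (fubini_tonelli2 (fun z => (\1_N z)%:E))//.
apply: integral0_eq => s _; rewrite /fubini_G.
pose t := dotp c s.
pose H u := [set x : V | dotp c x = u].
have mH u : measurable (H u) by apply: measurable_level; exact: measurable_dotp.
have H0 u : lebesgue_rV d (H u) = 0%E by exact: lebesgue_rV_hyperplane.
pose E := H m `|` H (m - t) `|` H (m + balance_point r t (phi s) (phi (- s))).
rewrite (@ge0_negligible_integral _ _ _ (lebesgue_rV d) setT E)//.
- apply: integral0_eq => x [_ /= nE].
  rewrite indicE memNset// => -[FG G0]; apply: nE.
  apply: contrapT => /not_orP[/not_orP[n1 n2] n3].
  have : flow (x, s) < flow_bound (x, s); last by rewrite FG ltxx.
  apply: crossing_lt; rewrite ?pi0 ?phi0//=.
  + by apply/eqP => /eqP; rewrite subr_eq0 => /eqP.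
  + by apply/eqP => E0; apply: n2; rewrite /H/= /t; lra.
  + by apply/eqP => E0; apply: n3; rewrite /H/= -E0; lra.
- by apply: measurableU => //; exact: measurableU.
- exact: (measurableT_comp mI (measurable_pair2 s)).
- have H12 : lebesgue_rV d (H m `|` H (m - t)) = 0%E.
    exact: null_set_setU (mH _) (mH _) (H0 _) (H0 _).
  exact: null_set_setU (measurableU _ _ (mH _) (mH _)) (mH _) H12 (H0 _).
Qed.

(** For a fixed step [s], translating the second half of the bound by [s] turns
    it into a charge at the same point as the first half, and on the two halves
    [(dotp c x - m) * dotp c s] has opposite signs: together they charge each
    point at most once. Summing over steps, [phi s + phi (- s)] has integral 2,
    and [2 `^ (r - 2) * 2 = 2 `^ (r - 1)]. *)
Lemma integral_flow_bound :
  (\int[lebesgue_rV d \x lebesgue_rV d]_z (flow_bound z)%:E <=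
   (2 `^ (r - 1))%:E *
     \int[lebesgue_rV d]_x (`|dotp c x - m| `^ r * pi x)%R%:E)%E.
Proof.
set W := (X in (_ * X)%E).
have mGE : measurable_fun setT (fun z => (flow_bound z)%:E).
  by apply/measurable_EFinP; exact: measurable_flow_bound.
have bound0 z : 0 <= flow_bound z by apply: (le_trans (flow_ge0 z)); exact: flow_le.
rewrite (fubini_tonelli2 (fun z => (flow_bound z)%:E))//.
have W0 : (0 <= W)%E by apply: integral_ge0 => x _; rewrite lee_fin mulr_ge0 ?powR_ge0.
have inner s : (\int[lebesgue_rV d]_x (flow_bound (x, s))%:E <=
    W * (2 `^ (r - 2) * (phi s + phi (- s)))%R%:E)%E.
  pose t := dotp c s.
  pose b (x : V) := `|dotp c x - m| `^ r * pi x.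
  have mb : measurable_fun setT b.
    apply: measurable_funM => //; apply: measurable_absR_powR.
    by apply: measurable_funB => //; exact: measurable_dotp.
  have b0 x : 0 <= b x by rewrite mulr_ge0 ?powR_ge0.
  (* [u] is charged at [x], [v] at [x + s]. *)
  pose u (x : V) := if (dotp c x - m) * t < 0 then b x else 0.
  pose v (x : V) := if 0 < (dotp c x - m) * t then b x else 0.
  have mt : measurable_fun setT (fun x : V => (dotp c x - m) * t).
    by apply: measurable_funM => //; apply: measurable_funB => //; exact: measurable_dotp.
  have mu : measurable_fun setT u.
    by apply: measurable_fun_ifT => //; exact: measurable_fun_ltr.
  have mv : measurable_fun setT v.
    by apply: measurable_fun_ifT => //; exact: measurable_fun_ltr.
  have u0 x : 0 <= u x by rewrite /u; case: ifP.
  have v0 x : 0 <= v x by rewrite /v; case: ifP.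
  have uE0 x : (0 <= (u x)%:E)%E by rewrite lee_fin.
  have vE0 x : (0 <= (v x)%:E)%E by rewrite lee_fin.
  have muE : measurable_fun setT (EFin \o u) by exact/measurable_EFinP.
  have mvE : measurable_fun setT (EFin \o v) by exact/measurable_EFinP.
  set K := 2 `^ (r - 2) * _.
  have K0 : 0 <= K by rewrite mulr_ge0 ?powR_ge0 ?addr_ge0.
  have mshift : measurable_fun setT (fun x : V => (v (x + s))%:E).
    by apply: (measurableT_comp mvE); exact: measurable_rVD.
  rewrite (eq_integral (fun x => ((u x)%:E + (v (x + s)%R)%:E) * K%:E)%E); last first.
    move=> x _; rewrite -EFinD -EFinM; congr (_%:E).
    rewrite /flow_bound /crossing_bound /= /u /v /b dotpD -/t (addrAC (dotp c x)) /K.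
    by rewrite mulrA [RHS]mulrC.
  rewrite ge0_integralZr//; last 2 first.
  - exact: emeasurable_funD.
  - by move=> x _; exact: adde_ge0 (uE0 _) (vE0 _).
  rewrite lee_wpmul2r ?lee_fin//.
  rewrite ge0_integralD//.
  rewrite (@integral_lebesgue_rV_shift _ _ s (EFin \o v))//.
  rewrite -ge0_integralD//; last by move=> x _; exact: vE0.
  apply: ge0_le_integral => //.
  - by move=> x _; exact: adde_ge0 (uE0 _) (vE0 _).
  - exact: emeasurable_funD.
  - exact/measurable_EFinP.
  - move=> x _; rewrite lee_fin /u /v.
    by case: (ltgtP ((dotp c x - m) * t) 0) => _; rewrite ?addr0 ?add0r ?lexx// b0.
have mphiNs : measurable_fun setT (fun s : V => phi (- s)).
  by apply: (measurableT_comp mphi); exact: measurable_rVN.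
have mphis : measurable_fun setT (fun s : V => phi s + phi (- s)).
  exact: measurable_funD.
have mK : measurable_fun setT (fun s : V => 2 `^ (r - 2) * (phi s + phi (- s))).
  exact: measurable_funM.
apply: (@le_trans _ _ (\int[lebesgue_rV d]_s
    (W * (2 `^ (r - 2) * (phi s + phi (- s)))%R%:E))%E).
  apply: ge0_le_integral => //.
  - move=> s _; apply: integral_ge0 => x _; rewrite lee_fin; exact: bound0.
  - exact: (measurable_fun_fubini_tonelli_G (fun z => (flow_bound z)%:E)).
  - apply: emeasurable_funM => //; exact/measurable_EFinP.
  - by move=> s _; exact: inner.
have phiE : (\int[lebesgue_rV d]_s (phi s + phi (- s))%R%:E = 2%:E)%E.
  have mphiE : measurable_fun setT (fun x => (phi x)%:E) by exact/measurable_EFinP.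
  have mphiNE : measurable_fun setT (fun x : V => (phi (- x))%:E).
    exact/measurable_EFinP.
  have phiE0 x : (0 <= (phi x)%:E)%E by rewrite lee_fin.
  under eq_integral do rewrite EFinD.
  rewrite (ge0_integralD _ measurableT _ mphiE _ mphiNE)//.
  by rewrite (@integral_lebesgue_rV_opp _ _ (fun x => (phi x)%:E))// phi1 -EFinD.
have sumE0 (s : V) : (0 <= (phi s + phi (- s))%:E)%E by rewrite lee_fin addr_ge0.
have KE0 (s : V) : (0 <= (2 `^ (r - 2) * (phi s + phi (- s)))%:E)%E.
  by rewrite lee_fin mulr_ge0 ?powR_ge0 ?addr_ge0.
have mKE : measurable_fun setT (fun s : V => (2 `^ (r - 2) * (phi s + phi (- s)))%:E).
  exact/measurable_EFinP.
have msE : measurable_fun setT (fun s : V => (phi s + phi (- s))%:E).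
  exact/measurable_EFinP.
rewrite (ge0_integralZl _ measurableT mKE)//.
under eq_integral do rewrite EFinM.
rewrite (ge0_integralZl _ measurableT msE)//.
rewrite phiE -EFinM muleC (_ : 2 `^ (r - 2) * 2 = 2 `^ (r - 1))//.
rewrite mulrC (_ : r - 2 = r - 1 - 1); last by lra.
by rewrite mulr_powRB1// subr_gt0 (lt_le_trans _ r2)// ltr1n.
Qed.

End crossing_integral.

(** * Moments of the stationary law and conclusion *)

Lemma dotp_le_enorm (R : realType) (d : nat) (c x : 'rV[R]_d) :
  `|dotp c x| <= (\sum_(i < d) `|c ord0 i|) * enorm x.
Proof.
apply: le_trans (ler_norm_sum _ _ _) _; rewrite mulr_suml.
apply: ler_sum => i _; rewrite normrM ler_wpM2l//.
rewrite /enorm -sqrtr_sqr ler_wsqrtr// /dotp (bigD1 i)//= -expr2 lerDl.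
by apply: sumr_ge0 => j _; rewrite -expr2 sqr_ge0.
Qed.

Lemma measurable_enorm (R : realType) (d : nat) :
  measurable_fun [set: 'rV[R]_d] (@enorm R d).
Proof.
have dotp0 (x : 'rV[R]_d) : 0 <= dotp x x.
  by apply: sumr_ge0 => i _; rewrite -expr2 sqr_ge0.
rewrite /enorm; under eq_fun do rewrite -powR12_sqrt ?dotp0//.
apply: (measurableT_comp (measurable_powR _)).
by apply: measurable_sum => i; apply: measurable_funM; exact: measurable_coor.
Qed.

Lemma linear_moment_fin (dO : measure_display) (Omega : measurableType dO)
    (R : realType) (P : probability Omega R) (d : nat) (r m : R)
    (c : 'rV[R]_d) (X : {RV P >-> 'rV[R]_d}) : 1 <= r ->
  (\int[P]_w (enorm (X w) `^ r)%:E < +oo)%E ->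
  (\int[P]_w (`|dotp c (X w) - m| `^ r)%:E < +oo)%E.
Proof.
move=> r1 Xr; pose A := \sum_(i < d) `|c ord0 i|.
have A0 : 0 <= A by exact: sumr_ge0.
have enorm0 (x : 'rV[R]_d) : 0 <= enorm x by exact: sqrtr_ge0.
have men : measurable_fun setT (fun w => enorm (X w) `^ r).
  apply: (measurableT_comp (measurable_powR r)).
  exact: (measurableT_comp (@measurable_enorm R d) (measurable_funPT X)).
have mdot : measurable_fun setT (fun w => `|dotp c (X w) - m| `^ r).
  apply: measurable_absR_powR; apply: measurable_funB => //.
  exact: (measurableT_comp (measurable_dotp c) (measurable_funPT X)).
have menE : measurable_fun setT (fun w => (enorm (X w) `^ r)%:E).
  exact/measurable_EFinP.
have mdotE : measurable_fun setT (fun w => (`|dotp c (X w) - m| `^ r)%:E).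
  exact/measurable_EFinP.
pose a := 2 `^ (r - 1) * A `^ r; pose b := 2 `^ (r - 1) * `|m| `^ r.
have a0 : 0 <= a by rewrite mulr_ge0 ?powR_ge0.
have b0 : 0 <= b by rewrite mulr_ge0 ?powR_ge0.
have mB : measurable_fun setT (fun w => (a%:E * (enorm (X w) `^ r)%:E)%E).
  exact: emeasurable_funM.
apply: (@le_lt_trans _ _ (\int[P]_w (a%:E * (enorm (X w) `^ r)%:E + b%:E))%E).
  apply: ge0_le_integral => //.
  - by apply: emeasurable_funD.
  - move=> w _; rewrite -EFinM -EFinD lee_fin.
    apply: (@le_trans _ _ ((A * enorm (X w) + `|m|) `^ r)).
      apply: powR_le_mono => //; first by rewrite (le_trans _ r1).
      by apply: (le_trans (ler_normB _ _)); rewrite lerD2r dotp_le_enorm.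
    apply: (le_trans (powR_add_le r1 _ _)) => //; first by rewrite mulr_ge0.
    by rewrite powRM// mulrDr mulrA.
have enE0 w : (0 <= (enorm (X w) `^ r)%:E)%E by rewrite lee_fin powR_ge0.
rewrite ge0_integralD//; last by move=> w _; rewrite mule_ge0.
rewrite (ge0_integralZl _ measurableT menE)//.
rewrite integral_cst//= probability_setT mule1 lte_add_pinfty ?ltry//.
by rewrite lte_mul_pinfty.
Qed.

(** A law with a density gives no mass to the hyperplane [dotp c x = m]. *)
Lemma centered_moment_gt0 (R : realType) (d : nat) (r m : R) (c : 'rV[R]_d)
    (pi : 'rV[R]_d -> R) : c != 0 -> is_density pi ->
  (0 < \int[lebesgue_rV d]_x (`|dotp c x - m| `^ r * pi x)%R%:E)%E.
Proof.
move=> c0 [mpi pi0 pi1].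
have b0 x : 0 <= `|dotp c x - m| `^ r * pi x by rewrite mulr_ge0 ?powR_ge0.
have mb : measurable_fun setT (fun x => (`|dotp c x - m| `^ r * pi x)%:E).
  apply/measurable_EFinP; apply: measurable_funM => //; apply: measurable_absR_powR.
  by apply: measurable_funB => //; exact: measurable_dotp.
rewrite lt_neqAle integral_ge0 ?andbT//; last by move=> x _; rewrite lee_fin.
apply/eqP => W0.
have Wabs : (\int[lebesgue_rV d]_x `|(`|dotp c x - m| `^ r * pi x)%R%:E| = 0)%E.
  by rewrite W0; apply: eq_integral => x _; rewrite gee0_abs// lee_fin.
have [E [mE E0 HE]] := (ae_eq_integral_abs _ measurableT mb).1 Wabs.
pose H := [set x : 'rV[R]_d | dotp c x = m].
have mH : measurable H by apply: measurable_level; exact: measurable_dotp.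
have H0 : lebesgue_rV d H = 0%E by exact: lebesgue_rV_hyperplane.
suff pi00 : (\int[lebesgue_rV d]_x (pi x)%:E = 0)%E.
  by move: pi1; rewrite pi00 => /eqP; rewrite eqe eq_sym oner_eq0.
rewrite (@ge0_negligible_integral _ _ _ (lebesgue_rV d) setT (E `|` H))//.
- apply: integral0_eq => x [_ /not_orP[/= xE xH]]; apply/eqP.
  rewrite eqe; apply: contrapT => pix; apply: xE; apply: HE => /= /(_ I) [] /eqP.
  rewrite mulf_eq0 powR_eq0 normr_eq0 subr_eq0 => /orP[/andP[/eqP]//|//].
- exact: measurableU.
- exact/measurable_EFinP.
- by move=> x _; rewrite lee_fin.
- exact: null_set_setU mE mH E0 H0.
Qed.

Theorem theorem3p1 (R : realType) (dO : measure_display)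
  (Omega : measurableType dO) (P : probability Omega R)
  (d : nat) (r m : R) (c : 'rV[R]_d) (pi phi : 'rV[R]_d -> R)
  (X : nat -> {RV P >-> 'rV[R]_d}) :
  (1 <= d)%N -> 2 <= r -> c != 0 ->
  is_density pi -> is_density phi ->
  stationary_rwmh pi phi X ->
  ('E_P[fun w => (enorm (X 0%N w) `^ r)%R] < +oo)%E ->
  ('E_P[fun w => (`|dotp c (X 1%N w - X 0%N w)| `^ r)%R] <
   (2 `^ (r - 1))%:E * 'E_P[fun w => (`|dotp c (X 0%N w) - m| `^ r)%R])%E.
Proof.
move=> _ r2 c0 dpi dphi sX; rewrite !unlock => Xr.
have [mpi pi0 pi1] := dpi; have [mphi phi0 phi1] := dphi.
have r0 : 0 < r by rewrite (lt_le_trans _ r2).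
have r1 : 1 <= r by rewrite (le_trans _ r2)// ler1n.
have mdev : measurable_fun setT (fun x : 'rV[R]_d => `|dotp c x - m| `^ r).
  apply: measurable_absR_powR; apply: measurable_funB => //; exact: measurable_dotp.
have WE := @expectation_density _ _ _ _ _ P (lebesgue_rV d) (X 0%N) pi mpi pi0
  sX.1 _ mdev (fun x => powR_ge0 _ _).
have Wpos := @centered_moment_gt0 R d r m c pi c0 dpi.
have Woo : (\int[lebesgue_rV d]_x (`|dotp c x - m| `^ r * pi x)%R%:E < +oo)%E.
  by rewrite -WE; exact: linear_moment_fin.
rewrite (rwmh_increment_expectation mpi pi0 mphi phi0
  (h := fun s => `|dotp c s| `^ r) sX); last 3 first.
- by apply: measurable_absR_powR; exact: measurable_dotp.
- by move=> s; exact: powR_ge0.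
- by rewrite /dotp big1 ?normr0 ?powR0 ?gt_eqF// => i _; rewrite mxE mulr0.
rewrite WE.
apply: (@integral_lt_bound _ _ _ _ _ (@flow_bound R d pi phi c r m)).
- exact: measurable_flow.
- exact: measurable_flow_bound.
- by move=> z; exact: flow_ge0.
- by move=> z; exact: flow_le.
- exact: flow_tight_null.
- exact: integral_flow_bound.
- by rewrite mule_gt0// lte_fin powR_gt0.
- by rewrite lte_mul_pinfty// lee_fin powR_ge0.
Qed.
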